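(* Assume that $(\lambda,\tau)$ is a threshold-tuple, and let $\sigma=\tau_{|\tau|}$ be the last element of $\tau$. Let $T,\mathcal B,y$ be the tree, the collection of processed subsets and the vector computed by $\mathtt{GP}(\lambda,\tau)$, and let $T',\mathcal B',y'$ be those computed by $\mathtt{GP}(\lambda,\widetilde\tau)$. Then $y=y'$ and (i) if $\sigma$ is an edge, then $\mathcal B=\mathcal B'$, $\sigma\notin E(T')$, and $T\subseteq T'+\sigma$; (ii) if $\sigma$ is a subset, then $T=T'$, $\sigma\notin\mathcal B'$, and $\mathcal B=\mathcal B'\cup\{\sigma\}$.
   Context: Instance: a finite connected undirected graph $G=(V,E)$, a root $r\in V$, an integer $0\le k\le|V|$, non-negative edge costs $c_e$, non-negative vertex penalties $\pi_v$ with $\pi_r=\infty$. For a potential $\lambda\ge0$ and $L\subseteq V$, $\pi^\lambda_L=\sum_{v\in L}\pi_v+\lambda|L|$. Let $y=(y_S)_{S\subseteq V}$ be a non-negative vector. For $L\subseteq V$ and a graph $H$, $\delta_H(L)$ is the set of edges of $H$ with exactly one extreme in $L$, and $\delta(L)=\delta_G(L)$. An edge $e$ is tight if $\sum_{L:e\in\delta(L)}y_L=c_e$; a subset $L\subseteq V$ is tight if $\sum_{S\subseteq L}y_S=\pi^\lambda_L$. Growth-phase $\mathtt{GP}(\lambda,\tau)$: here $\tau$ is a tie-breaking list, i.e. a finite (possibly empty) sequence $\tau_1,\dots,\tau_{|\tau|}$ of edges of $G$ and subsets of $V$. The algorithm maintains a forest $F\subseteq G$, collections $\mathcal B\subseteq\mathcal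 L\subseteq2^V$ and the vector $y$. $\mathcal L^*$ denotes the collection of inclusion-wise maximal members of $\mathcal L$ (it always partitions $V$); an edge is external in $\mathcal L^*$ if its extremes lie in two distinct members of $\mathcal L^*$, called its endpoints; the members of $\mathcal A=\mathcal L^*\setminus\mathcal B$ are called active. Initially $F=(V,\emptyset)$, $\mathcal L=\{\{v\}:v\in V\}$, $\mathcal B=\emptyset$, $y=0$. In iteration $i=1,2,\dots$: (1) if $\mathcal A=\{V\}$, return $(T,\mathcal B)$ with $T=F$. (2) Let $\Delta_1=0$ if some external edge is tight, and otherwise let $\Delta_1$ be the minimum of $\big(c_e-\sum_{L:e\in\delta(L)}y_L\big)/|\{L\in\mathcal A:e\in\delta(L)\}|$ over edges $e\in\delta(S)$, $S\in\mathcal A$; let $\Delta_2=0$ if some active subset is tight, and otherwise $\Delta_2=\min_{L\in\mathcal A}\big(\pi^\lambda_L-\sum_{S\subseteq L}y_S\big)$; increase $y_L$ by $\min\{\Delta_1,\Delta_2\}$ for every $L\in\mathcal A$. (3) Let $\mathcal Y$ be the set of tight external edges and $\mathcal Z$ the collection of tight active subsets. If $i\le|\tau|$ and $\tau_i\in\mathcal Y\cup\mathcal Z$, let $\sigma=\tau_i$; else, if $\mathcal Y\ne\emptyset$, let $\sigma$ be the first edge of $\mathcal Y$; else let $\sigma$ be the first subset of $\mathcal Z$ (''first'' refers to a fixed order on edges and a fixed order on subsets). (4) If $\sigma$ is an edge with endpoints $L_1,L_2$, add $\sigma$ to $F$ and $L_1\cup L_2$ to $\mathcal L$; if $\sigma$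 is a subset, add $\sigma$ to $\mathcal B$. We say $\sigma$ is processed in iteration $i$. The final $y$ and $\mathcal L$ are said to be computed by $\mathtt{GP}(\lambda,\tau)$. Pruning-phase $\mathtt{PP}(H,\mathcal B)$: while there is $B\in\mathcal B$ with $|\delta_H(B)|=1$, delete the vertices of $B$ from $H$; return $H$. Modified Goemans–Williamson algorithm $\mathtt{GW}(\lambda,\tau)$: let $(T,\mathcal B)$ be returned by $\mathtt{GP}(\lambda,\tau)$ and return $\mathtt{PP}(T,\mathcal B)$. For a non-empty tie-breaking list $\tau$, $\widetilde\tau$ is its prefix of size $|\tau|-1$. The list $\tau$ is respected by $\lambda$ if the sequence of edges and subsets processed in the first $|\tau|$ iterations of $\mathtt{GP}(\lambda,\tau)$ is exactly $\tau$. The pair $(\lambda,\tau)$ is a threshold-tuple if $\tau$ is respected by $\lambda$ and, with $\widehat T=\mathtt{GW}(\lambda,\tau)$ and $\widehat T'=\mathtt{GW}(\lambda,\widetilde\tau)$, either $|V(\widehat T)|\ge k>|V(\widehat T')|$ or $|V(\widehat T)|<k\le|V(\widehat T')|$. *)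

(* Defs.v *)
From HB Require Import structures.
From mathcomp Require Import all_boot all_order all_algebra.
From mathcomp Require Import constructive_ereal.

Set Implicit Arguments.
Unset Strict Implicit.
Unset Printing Implicit Defensive.

Import Order.TTheory GRing.Theory Num.Theory.
Local Open Scope ring_scope.

(* An edge is the set of its two extremes. *)
Record graph (V : finType) := Graph {
  vset : {set V};
  eset : {set {set V}}
}.

Section Graphs.
Variable V : finType.
Implicit Types (H : graph V) (e B L : {set V}).

Definition subgraph H1 H2 : Prop :=
  vset H1 \subset vset H2 /\ eset H1 \subset eset H2.

Definition add_edge H e : graph V := Graph (vset H) (e |: eset H).

Definition delete_vertices H B : graph V :=
  Graph (vset H :\: B) [set e in eset H | [disjoint e & B]].

(* The edges of D with exactly one extreme in L. *)
Definition cut (D : {set {set V}}) L : {set {set V}} :=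
  [set e in D | #|e :&: L| == 1%N].

(* [pruning Bs H H']: some execution of the pruning phase on (H, Bs) returns
   H'; the member of Bs deleted at each round is arbitrary. *)
Inductive pruning (Bs : {set {set V}}) : graph V -> graph V -> Prop :=
| PruneStop H :
    (forall B, B \in Bs -> #|cut (eset H) B| != 1%N) -> pruning Bs H H
| PruneStep H B H' :
    B \in Bs -> #|cut (eset H) B| = 1%N ->
    pruning Bs (delete_vertices H B) H' -> pruning Bs H H'.

Definition least (T : finType) (le : rel T) (A : {set T}) : option T :=
  [pick x in A | [forall z in A, le x z]].

(* [inl e] is the edge e and [inr L] is the subset L: a two-element set may
   occur in either role. *)
Definition item : Type := ({set V} + {set V})%type.

End Graphs.

(* The graph is ([set: V], edges); [edge_le] and [set_le] are the fixed orders
   that give "first" its meaning. *)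
Record instance (R : realFieldType) (V : finType) := Instance {
  edges : {set {set V}};
  root : V;
  quota : nat;
  cost : {set V} -> R;
  penalty : V -> \bar R;
  edge_le : rel {set V};
  set_le : rel {set V};
  card_edge : forall e, e \in edges -> #|e| = 2;
  edges_connected :
    forall u v : V, connect (fun x y => [set x; y] \in edges) u v;
  quota_le : (quota <= #|V|)%N;
  cost_ge0 : forall e, e \in edges -> 0 <= cost e;
  penalty_ge0 : forall v, (0 <= penalty v)%E;
  penalty_root : penalty root = +oo%E;
  edge_le_total : {in edges &, total edge_le};
  edge_le_anti : {in edges &, antisymmetric edge_le};
  edge_le_trans : {in edges & &, transitive edge_le};
  set_le_total : total set_le;
  set_le_anti : antisymmetric set_le;
  set_le_trans : transitive set_le
}.

(* [family] is the collection \mathcal L and [blocked] is \mathcal B. *)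
Record state (R : realFieldType) (V : finType) := State {
  forest : graph V;
  family : {set {set V}};
  blocked : {set {set V}};
  dual : {ffun {set V} -> R}
}.

Section GrowthPhase.
Variables (R : realFieldType) (V : finType) (I : instance R V) (lambda : R).
Implicit Types (s : state R V) (e L S : {set V}) (tau p : seq (item V)).

Definition delta L : {set {set V}} := cut (edges I) L.

Definition set_penalty L : \bar R :=
  (\sum_(v in L) penalty I v + (lambda * #|L|%:R)%:E)%E.

Definition edge_load s e : R := \sum_(L : {set V} | e \in delta L) dual s L.

Definition set_load s L : R := \sum_(S : {set V} | S \subset L) dual s S.

Definition edge_tight s e : bool := edge_load s e == cost I e.

Definition set_tight s L : bool := (set_load s L)%:E == set_penalty L.

Definition maximal s : {set {set V}} :=
  [set L | maxset (fun S => S \in family s) L].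

Definition active s : {set {set V}} := maximal s :\: blocked s.

(* The members of [maximal s] containing an extreme of e; since [maximal s]
   partitions V, e is external exactly when there are two of them. *)
Definition endpoints s e : {set {set V}} :=
  [set L in maximal s | e :&: L != set0].

Definition external s : {set {set V}} :=
  [set e in edges I | #|endpoints s e| == 2].

Definition tight_external s : {set {set V}} :=
  [set e in external s | edge_tight s e].

Definition tight_active s : {set {set V}} :=
  [set L in active s | set_tight s L].

Definition Delta1 s : \bar R :=
  if tight_external s != set0 then 0%E
  else \big[Order.min/+oo%E]_(e in edges I | [exists S in active s, e \in delta S])
         ((cost I e - edge_load s e)
            / #|[set L in active s | e \in delta L]|%:R)%:E.

Definition Delta2 s : \bar R :=
  if tight_active s != set0 then 0%E
  else \big[Order.min/+oo%E]_(L in active s)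
         (set_penalty L - (set_load s L)%:E)%E.

(* [fine] is harmless: connectedness and penalty_root make Delta1 finite as
   long as [active s != [set setT]]. *)
Definition increment s : R := fine (Order.min (Delta1 s) (Delta2 s)).

Definition grow s : state R V :=
  State (forest s) (family s) (blocked s)
    [ffun L => if L \in active s then dual s L + increment s else dual s L].

Definition candidate s (x : item V) : bool :=
  match x with
  | inl e => e \in tight_external s
  | inr L => L \in tight_active s
  end.

Definition default_item s : option (item V) :=
  if tight_external s != set0
  then omap inl (least (edge_le I) (tight_external s))
  else omap inr (least (set_le I) (tight_active s)).

(* Positions in tau are counted from 0 here, so iteration i of the algorithm
   uses [select tau i.-1]. *)
Definition select tau (j : nat) s : option (item V) :=
  if onth tau j is Some x
  then if candidate s x then Some x else default_item s
  else default_item s.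

Definition process s (x : item V) : state R V :=
  match x with
  | inl e => State (add_edge (forest s) e)
               ((\bigcup_(L in endpoints s e) L) |: family s)
               (blocked s) (dual s)
  | inr L => State (forest s) (family s) (L |: blocked s) (dual s)
  end.

Definition initial_state : state R V :=
  State (Graph setT set0) [set [set v] | v : V] set0 [ffun=> 0].

(* [growth tau p s]: after its first [size p] iterations, in which the items
   of p are processed in this order, the growth phase is in state s. *)
Inductive growth tau : seq (item V) -> state R V -> Prop :=
| GrowthInit : growth tau [::] initial_state
| GrowthStep p s x :
    growth tau p s -> active s != [set setT] ->
    select tau (size p) (grow s) = Some x ->
    growth tau (rcons p x) (process (grow s) x).

Definition GP tau p s : Prop := growth tau p s /\ active s = [set setT].

Definition GW tau (H : graph V) : Prop :=
  exists p s, GP tau p s /\ pruning (blocked s) (forest s) H.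

Definition tie_breaking_list tau : Prop :=
  forall e, inl e \in tau -> e \in edges I.

Definition respected tau : Prop :=
  exists p s, GP tau p s /\ take (size tau) p = tau.

Definition list_prefix tau : seq (item V) := take (size tau).-1 tau.

Definition threshold_tuple tau : Prop :=
  [/\ tau <> [::], respected tau &
    exists H H' : graph V,
      [/\ GW tau H, GW (list_prefix tau) H' &
        (#|vset H'| < quota I <= #|vset H|)%N
        \/ (#|vset H| < quota I <= #|vset H'|)%N]].

End GrowthPhase.

(* Main.v *)
From HB Require Import structures.
From mathcomp Require Import all_boot all_order all_algebra.
From mathcomp Require Import constructive_ereal.
Require Import Defs.

(* After |tau|-1 iterations both executions are in the same state g, in which
   sigma is tight; one of them processes sigma, the other the first tight item.
   As long as a tight item exists no dual variable grows, so both go through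
   the items tight in g, edges before subsets.  The rest of an execution depends
   on the forest only through its connected components.  If sigma is an edge,
   the other execution eventually adds an edge f joining the same two components
   as sigma, as in Kruskal's algorithm, and from then on the forests differ only
   by exchanging sigma for f.  If sigma is a subset, the other execution either
   processes sigma later, or processes a tight edge that crosses it, after which
   sigma is no longer maximal and its being blocked is irrelevant.  When f = sigma
   or sigma is processed later, both executions return the same pair (T, B);
   pruning is confluent, because B is laminar and avoids the root and T is
   connected, so this contradicts the threshold-tuple. *)

Set Implicit Arguments.
Unset Strict Implicit.
Unset Printing Implicit Defensive.

Import Order.TTheory GRing.Theory Num.Theory.
Local Open Scope ring_scope.

(** * Cuts and the cycle closure of a set of edges *)

Section SaturatedSets.
Variable V : finType.
Implicit Types (e f g X Y : {set V}) (D : {set {set V}}).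

Definition crosses e X := #|e :&: X| == 1%N.

(** For edges with two extremes these are the unions of connected components of the graph with edge
    set [D]. Using them replaces paths by parity arguments. *)
Definition saturated D X := cut D X == set0.

Definition symdiff X Y := (X :\: Y) :|: (Y :\: X).

(* Some bond separates the extremes of f and avoids D: f is not in the cycle
   closure of D. *)
Definition separated D f := [exists X, saturated D X && crosses f X].

Lemma crosses2 a b X : a != b -> crosses [set a; b] X = (a \in X) (+) (b \in X).
Proof.
move=> ab; rewrite /crosses setIUl.
have E c : [set c] :&: X = if c \in X then [set c] else set0.
  by apply/setP=> d; case: ifP => cX; rewrite !inE; case: eqP => // ->; rewrite cX.
rewrite !E; case: (a \in X) (b \in X) => [] [] /=;
  by rewrite ?set0U ?setU0 ?cards2 ?cards1 ?cards0 ?ab.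
Qed.

Lemma edgeP e : #|e| = 2 -> exists a b, a != b /\ e = [set a; b].
Proof. by move/eqP/cards2P. Qed.

(** Crossing a two-element edge is the parity of [#|e :&: X|], which is linear over GF(2) in [X];
    both exchange lemmas below rest on this. *)
Lemma crosses_symdiff e X Y :
  #|e| = 2 -> crosses e (symdiff X Y) = crosses e X (+) crosses e Y.
Proof.
case/edgeP=> a [b [ab ->]]; rewrite !crosses2 // !inE.
by do 4!case: (_ \in _).
Qed.

Lemma crosses_meets e X : crosses e X -> e :&: X != set0.
Proof. by rewrite /crosses -card_gt0 => /eqP ->. Qed.

Lemma disjoint2 a b X : [disjoint [set a; b] & X] = (a \notin X) && (b \notin X).
Proof. by rewrite disjoints_subset subUset !sub1set !inE. Qed.

Lemma saturatedP D X :
  reflect {in D, forall e, ~~ crosses e X} (saturated D X).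
Proof.
apply: (iffP eqP) => [c0 e De | h].
  by apply/negP => eX; have := in_set0 e; rewrite -c0 inE De -/(crosses e X) eX.
apply/setP => e; rewrite !inE; apply/negP => /andP[De eX].
by have := h e De; rewrite /crosses eX.
Qed.

Lemma saturatedPn D X :
  reflect (exists2 e, e \in D & crosses e X) (~~ saturated D X).
Proof.
rewrite /saturated; apply: (iffP (set0Pn _)) => [[e]|[e De eX]].
  by rewrite inE => /andP[]; exists e.
by exists e; rewrite inE De.
Qed.

Lemma saturatedU1 D e X : saturated (e |: D) X = ~~ crosses e X && saturated D X.
Proof.
apply/saturatedP/andP => [h | [eX /saturatedP h] f].
  split; first by rewrite h ?setU11.
  by apply/saturatedP => f Df; rewrite h ?setU1r.
by rewrite !inE => /predU1P[-> //|/h].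
Qed.

Lemma saturated_symdiff D X Y : {in D, forall e, #|e| = 2} ->
  saturated D X -> saturated D Y -> saturated D (symdiff X Y).
Proof.
move=> D2 /saturatedP hX /saturatedP hY; apply/saturatedP => e De.
by rewrite crosses_symdiff ?D2 // (negPf (hX e De)) (negPf (hY e De)).
Qed.

Lemma separatedP D f :
  reflect (exists2 X, saturated D X & crosses f X) (separated D f).
Proof.
by apply: (iffP existsP) => [[X /andP[]]|[X sX fX]]; exists X; rewrite ?sX.
Qed.

Lemma separatedU1 D e f : separated (e |: D) f -> separated D f.
Proof.
by case/separatedP => X; rewrite saturatedU1 => /andP[_ sX] fX; apply/separatedP; exists X.
Qed.

Lemma separated_mem D e : e \in D -> ~~ separated D e.
Proof.
by move=> De; apply/separatedP => -[X /saturatedP/(_ e De) /negPf ->].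
Qed.

(** Exchange property of the graphic matroid. If the set [X] separating [e] also separates [f], it
    is corrected by adding modulo 2 a set [Y] that separates [f] but not [e]. *)
Lemma separated_exchange D e f :
  {in D, forall g, #|g| = 2} -> #|e| = 2 -> #|f| = 2 ->
  separated D e -> separated (e |: D) f -> separated (f |: D) e.
Proof.
move=> D2 e2 f2 /separatedP[X sX eX] /separatedP[Y].
rewrite saturatedU1 => /andP[eY sY] fY; apply/separatedP.
case fX: (crosses f X); last by exists X; rewrite // saturatedU1 fX.
exists (symdiff X Y).
  by rewrite saturatedU1 saturated_symdiff // crosses_symdiff // fX fY.
by rewrite crosses_symdiff // eX (negPf eY).
Qed.

(** A [D]-saturated [X] crossed by exactly one of [e] and [f] would yield, as [X] itself or as its
    symmetric difference with [Y], a set that is saturated for [e |: D] and crossed by [f]. So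
    exchanging [e] for [f] preserves the components. *)
Lemma saturated_exchange D e f :
  {in D, forall g, #|g| = 2} -> #|e| = 2 -> #|f| = 2 ->
  separated D f -> ~~ separated (e |: D) f ->
  saturated (e |: D) =1 saturated (f |: D).
Proof.
move=> D2 e2 f2 /separatedP[Y sY fY] nf.
have eY : crosses e Y.
  by apply: contraR nf => eY; apply/separatedP; exists Y; rewrite // saturatedU1 eY.
move=> X; rewrite !saturatedU1; case sX: (saturated D X); last by rewrite !andbF.
rewrite !andbT; congr negb; apply/idP/idP => [eX|fX]; apply: contraR nf => nX;
  apply/separatedP; [exists (symdiff X Y) | exists X] => //.
- by rewrite saturatedU1 saturated_symdiff // crosses_symdiff // eX eY.
- by rewrite crosses_symdiff // fY (negPf nX).
- by rewrite saturatedU1 nX.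
Qed.

End SaturatedSets.

(** * Confluence of the pruning phase *)

Section Pruning.
Variables (V : finType) (r : V).
Implicit Types (H : graph V) (e A B X : {set V}) (Bs : {set {set V}}).

Definition laminar Bs := forall A B, A \in Bs -> B \in Bs ->
  [\/ A \subset B, B \subset A | [disjoint A & B]].

(* [rg_linked] expresses connectedness of H through cuts: every vertex of H is
   joined to r. *)
Record rooted_graph H : Prop := RootedGraph {
  rg_card : {in eset H, forall e, #|e| = 2};
  rg_sub : {in eset H, forall e, e \subset vset H};
  rg_linked : forall X, r \notin X -> X :&: vset H != set0 ->
    ~~ saturated (eset H) X
}.

Lemma single_cutP D B : #|cut D B| = 1%N ->
  exists f, [/\ f \in D, crosses f B & {in D, forall e, crosses e B -> e = f}].
Proof.
move/eqP/cards1P => [f cf]; exists f.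
have := set11 f; rewrite -cf inE => /andP[Df fB].
split=> // e De eB; apply/set1P; rewrite -cf inE De; exact: eB.
Qed.

Lemma delete_verticesC H A B :
  delete_vertices (delete_vertices H A) B = delete_vertices (delete_vertices H B) A.
Proof.
rewrite /delete_vertices /=; congr Graph; first by rewrite !setDDl setUC.
by apply/setP => e; rewrite !inE andbAC.
Qed.

Lemma card_delete_vertices H B : #|cut (eset H) B| = 1%N ->
  (#|eset (delete_vertices H B)| < #|eset H|)%N.
Proof.
case/single_cutP => f [Hf fB _]; apply: proper_card; apply/properP; split.
  by apply/subsetP => e; rewrite inE => /andP[].
exists f => //; rewrite inE Hf /= -setI_eq0; exact: crosses_meets.
Qed.

(** Linkedness is applied to [X :\: B] and to [X :|: B]. If both crossing edges meet [B], both are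
    the unique edge [f] leaving [B], whose extreme outside [B] would have to lie both inside and
    outside [X]. *)
Lemma rooted_delete_vertices H B : rooted_graph H -> r \notin B ->
  #|cut (eset H) B| = 1%N -> rooted_graph (delete_vertices H B).
Proof.
move=> [H2 Hs Hl] rB /single_cutP[f [Hf fB uf]]; split=> [e|e|X rX].
- by rewrite inE => /andP[/H2].
- rewrite inE => /andP[/Hs eH eB] /=.
  by rewrite subsetD eH.
rewrite /= => /set0Pn[v]; rewrite !inE => /and3P[vX vB vH].
have [||e He] := @saturatedPn _ _ _ (Hl (X :\: B) _ _).
- by rewrite inE negb_and rX orbT.
- by apply/set0Pn; exists v; rewrite !inE vX vB.
move=> eXB; have [a [b [ab E]]] := edgeP (H2 e He).
case eB: [disjoint e & B].
  apply/saturatedPn; exists e; first by rewrite inE He.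
  move: eXB eB; rewrite E disjoint2 !crosses2 // !inE => h /andP[/negPf aB /negPf bB].
  by move: h; rewrite aB bB.
have ef : e = f.
  apply: uf => //; move: eXB eB; rewrite E disjoint2 !crosses2 // !inE.
  by do 4!case: (_ \in _).
have [||e' He'] := @saturatedPn _ _ _ (Hl (X :|: B) _ _).
- by rewrite inE negb_or rX.
- by apply/set0Pn; exists v; rewrite !inE vX vH.
move=> eXB'; have [a' [b' [ab' E']]] := edgeP (H2 e' He').
case eB': [disjoint e' & B].
  apply/saturatedPn; exists e'; first by rewrite inE He'.
  move: eXB' eB'; rewrite E' disjoint2 !crosses2 // !inE => h /andP[/negPf aB /negPf bB].
  by move: h; rewrite aB bB !orbF.
have ef' : e' = e.
  rewrite ef; apply: uf => //; move: eXB' eB'; rewrite E' disjoint2 !crosses2 // !inE.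
  by do 4!case: (_ \in _).
move: eXB eXB'; rewrite ef' E !crosses2 // !inE.
move: fB; rewrite -ef E crosses2 //.
by do 4!case: (_ \in _).
Qed.

Lemma delete_vertices_id H A : rooted_graph H ->
  A :&: vset H = set0 -> delete_vertices H A = H.
Proof.
move=> [_ Hs _] A0; case: H Hs A0 => vs es /= Hs A0; congr Graph.
  by apply/setDidPl; rewrite -setI_eq0 setIC A0.
apply/setP => e; rewrite inE; case: (boolP (e \in es)) => //= /Hs es_vs.
by rewrite -setI_eq0 -subset0 -A0 setIC setIS.
Qed.

(** If the edge [fB] leaving [B] avoids [A], it is still the only one after [A] is deleted.
    Otherwise laminarity and linkedness to the root show that no vertex of [B] survives the deletion
    of [A]. *)
Lemma pruning_local_confluence H A B : rooted_graph H ->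
  [\/ A \subset B, B \subset A | [disjoint A & B]] ->
  r \notin A -> r \notin B ->
  #|cut (eset H) A| = 1%N -> #|cut (eset H) B| = 1%N ->
  delete_vertices (delete_vertices H A) B = delete_vertices H A \/
  #|cut (eset (delete_vertices H A)) B| = 1%N.
Proof.
move=> gH lAB rA rB A1 B1.
have gHA := rooted_delete_vertices gH rA A1.
have [fA [HfA fAA uA]] := single_cutP A1.
have [fB [HfB fBB uB]] := single_cutP B1.
have [H2 Hs Hl] := gH.
have [fA_B|fB_A] := boolP [disjoint fB & A].
  right; apply/eqP/cards1P; exists fB; apply/setP => e; rewrite !inE.
  apply/idP/eqP => [/andP[/andP[He _] eB]|->]; first exact: uB.
  by rewrite HfB fA_B; exact: fBB.
left; apply: delete_vertices_id => //=; have [a [b [ab E]]] := edgeP (H2 _ HfB).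
case: lAB => [AB|BA|dAB].
- have fAE : fB = fA.
    apply: uA => //; have := fBB; have := fB_A; rewrite E disjoint2 !crosses2 //.
    have := subsetP AB a; have := subsetP AB b.
    by do 4!case: (_ \in _) => //; move=> // h1 h2; rewrite ?(h1 isT) ?(h2 isT).
  (* A surviving vertex of [B :\: A] needs an edge leaving this set, which could only be [fB = fA];
     but the extreme of that edge in [B] lies in [A]. *)
  apply/eqP; apply: contraT => ne.
  have [||e He] := @saturatedPn _ _ _ (Hl (B :\: A) _ _).
  + by rewrite inE negb_and rB orbT.
  + by rewrite setIDAC -setIDA.
  move=> eBA; have [a' [b' [ab' E']]] := edgeP (H2 _ He).
  have eE : e = fB.
    have [eA|eA] := boolP (crosses e A); first by rewrite fAE; apply: uA.
    apply: uB => //; move: eBA eA; rewrite E' !crosses2 // !inE.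
    have := subsetP AB a'; have := subsetP AB b'.
    by do 4!case: (_ \in _) => //; move=> // h1 h2; rewrite ?(h1 isT) ?(h2 isT).
  move: eBA fAA fBB; rewrite eE -fAE E !crosses2 // !inE.
  have := subsetP AB a; have := subsetP AB b.
  by do 4!case: (_ \in _) => //; move=> // h1 h2; rewrite ?(h1 isT) ?(h2 isT).
- by apply/eqP; rewrite -subset0; apply/subsetP => v; rewrite !inE => /andP[/(subsetP BA) ->].
have dAB' v : (v \in A) && (v \in B) = false.
  by apply/negP => /andP[vA vB]; move/pred0P/(_ v): dAB; rewrite /= vA vB.
have fAE : fB = fA.
  apply: uA => //; have := fBB; have := fB_A; rewrite E disjoint2 !crosses2 //.
  have := dAB' a; have := dAB' b.
  by do 4!case: (_ \in _).
(* The edge [fA = fB] joins [A] to [B], so nothing leaves [A :|: B], which would be cut off from the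
   root: the disjoint case is impossible. *)
have [||e He] := @saturatedPn _ _ _ (Hl (A :|: B) _ _).
- by rewrite inE negb_or rA.
- apply/set0Pn; have /set0Pn[v] := crosses_meets fAA; rewrite !inE => /andP[vf vA].
  by exists v; rewrite !inE vA (subsetP (Hs _ HfA)).
move=> eAB; have [a' [b' [ab' E']]] := edgeP (H2 _ He).
have eE : e = fB.
  have [eA|eA] := boolP (crosses e A); first by rewrite fAE; apply: uA.
  apply: uB => //; move: eAB eA; rewrite E' !crosses2 // !inE.
  have := dAB' a'; have := dAB' b'.
  by do 4!case: (_ \in _).
move: eAB fAA fBB; rewrite eE -fAE E !crosses2 // !inE.
have := dAB' a; have := dAB' b.
by do 4!case: (_ \in _).
Qed.

Lemma pruning_exists Bs H : exists N, pruning Bs H N.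
Proof.
have [n] := ubnP #|eset H|; elim: n H => // n IH H leHn.
case: (pickP [pred B in Bs | #|cut (eset H) B| == 1%N]) => [B /andP[/= BB /eqP B1]|none].
  have [|N HN] := IH (delete_vertices H B).
    by apply: leq_trans (card_delete_vertices B1) _; rewrite -ltnS.
  by exists N; apply: PruneStep BB B1 HN.
by exists H; apply: PruneStop => B BB; have := none B; rewrite /= BB /= => ->.
Qed.

(** Newman's argument, by induction on the number of edges. *)
Lemma pruning_unique Bs H H1 H2 : laminar Bs ->
  {in Bs, forall B, r \notin B} -> rooted_graph H ->
  pruning Bs H H1 -> pruning Bs H H2 -> H1 = H2.
Proof.
move=> lBs rBs; have [n] := ubnP #|eset H|; elim: n H H1 H2 => // n IH H H1 H2 leHn gH.
move=> p1; case: H H1 / p1 leHn gH => [H stop|H A H1 BsA A1 p1] leHn gH p2.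
  case: H H2 / p2 stop {leHn gH} => // H B H2 BsB B1 _ stop.
  by have := stop B BsB; rewrite B1.
case: H H2 / p2 leHn gH A1 p1 => [H stop|H B H2 BsB B1 p2] leHn gH A1 p1.
  by have := stop A BsA; rewrite A1.
have ltA : (#|eset (delete_vertices H A)| < n)%N.
  by apply: leq_trans (card_delete_vertices A1) _; rewrite -ltnS.
have ltB : (#|eset (delete_vertices H B)| < n)%N.
  by apply: leq_trans (card_delete_vertices B1) _; rewrite -ltnS.
have gA := rooted_delete_vertices gH (rBs _ BsA) A1.
have gB := rooted_delete_vertices gH (rBs _ BsB) B1.
(* [N] is a common result after both deletions. If the second deletion is vacuous, [N] is already a
   result for the once-pruned graph; otherwise one more pruning step leads to it. *)
have [N pN] := pruning_exists Bs (delete_vertices (delete_vertices H A) B).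
have -> : H1 = N.
  apply: IH p1 _ => //.
  case: (pruning_local_confluence gH (lBs _ _ BsA BsB) (rBs _ BsA) (rBs _ BsB) A1 B1) => [<- //|].
  by move=> c1; apply: PruneStep BsB c1 pN.
apply: IH _ p2 => //; rewrite delete_verticesC in pN.
case: (pruning_local_confluence gH (lBs _ _ BsB BsA) (rBs _ BsB) (rBs _ BsA) B1 A1) => [<- //|].
by move=> c1; apply: PruneStep BsA c1 pN.
Qed.

End Pruning.

(** * Invariants of the growth phase *)

Section GrowthInvariant.
Variables (R : realFieldType) (V : finType) (I : instance R V) (lambda : R).
Hypothesis lambda_ge0 : 0 <= lambda.
Implicit Types (s : state R V) (e f L M S X : {set V}) (tau p : seq (item V)).

Local Notation edge_set s := (eset (forest s)).

(** [inv_saturated] and [inv_linked] are what identifies the maximal members with the components of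
    the forest. [inv_penalty] and [inv_cost] are dual feasibility and keep increments non-negative;
    [inv_support] lets the load of a merged set split; [inv_laminar] and [inv_blocked] serve the
    confluence of pruning. *)
Record invariant s : Prop := Invariant {
  inv_vset : vset (forest s) = setT;
  inv_edges : edge_set s \subset edges I;
  inv_set1 : forall v, [set v] \in family s;
  inv_neq0 : {in family s, forall L, L != set0};
  inv_laminar : laminar (family s);
  inv_saturated : {in maximal s, forall L, saturated (edge_set s) L};
  inv_linked : {in family s, forall L X,
    saturated (edge_set s) X -> L :&: X != set0 -> L \subset X};
  inv_blocked : {in blocked s, forall L, L \in family s /\ root I \notin L};
  inv_support : forall L, dual s L != 0 -> L \in family s;
  inv_penalty : {in maximal s, forall L,
    ((set_load s L)%:E <= set_penalty I lambda L)%E};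
  inv_cost : {in edges I, forall e, edge_load I s e <= cost I e}
}.

Lemma maximalP s L : reflect
  (L \in family s /\ {in family s, forall M, L \subset M -> M = L}) (L \in maximal s).
Proof. by rewrite inE; apply: maxsetP. Qed.

Lemma maximal_family s L : L \in maximal s -> L \in family s.
Proof. by case/maximalP. Qed.

Lemma maximal_above s L : L \in family s -> exists2 M, M \in maximal s & L \subset M.
Proof.
by case/(maxset_exists (P := fun S => S \in family s)) => M ? ?; exists M; rewrite // inE.
Qed.

Lemma active_maximal s L : L \in active s -> L \in maximal s.
Proof. by rewrite inE => /andP[]. Qed.

Lemma inv_card s : invariant s -> {in edge_set s, forall e, #|e| = 2}.
Proof. by move=> J e /(subsetP (inv_edges J)) /card_edge. Qed.

(** * Maximal members as components of the forest *)

Section Partition.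
Variable s : state R V.
Hypothesis J : invariant s.

Lemma maximal_block v : exists2 M, M \in maximal s & v \in M.
Proof.
have [M Mmax vM] := maximal_above (inv_set1 J v).
by exists M; rewrite // -sub1set.
Qed.

Lemma maximal_eq L M : L \in maximal s -> M \in maximal s -> L :&: M != set0 -> L = M.
Proof.
move=> /maximalP[Lf Lmax] /maximalP[Mf Mmax] LM.
case: (inv_laminar J Lf Mf) => [/Lmax->|/Mmax<-|] //.
by rewrite -setI_eq0 (negPf LM).
Qed.

Lemma maximal_eq_mem v L M :
  L \in maximal s -> M \in maximal s -> v \in L -> v \in M -> L = M.
Proof.
by move=> Lm Mm vL vM; apply: maximal_eq => //; apply/set0Pn; exists v; rewrite inE vL.
Qed.

Lemma endpoints2 a b L M : L \in maximal s -> M \in maximal s -> a \in L -> b \in M ->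
  endpoints s [set a; b] = [set L; M].
Proof.
move=> Lm Mm aL bM; apply/setP => S; rewrite in_set2 /endpoints inE.
apply/andP/orP => [[Sm /set0Pn[v]]|].
  rewrite !inE => /andP[/orP[]/eqP-> vS]; [left|right]; apply/eqP; exact: maximal_eq_mem vS _.
case=> /eqP->; split=> //; apply/set0Pn.
  by exists a; rewrite !inE eqxx aL.
by exists b; rewrite !inE eqxx orbT bM.
Qed.

Lemma external_split e : e \in external I s ->
  exists a b L M, [/\ a != b, e = [set a; b], L \in maximal s /\ M \in maximal s,
     a \in L /\ b \in M & L != M /\ endpoints s e = [set L; M]].
Proof.
rewrite inE => /andP[eE]; have [a [b [ab E]]] := edgeP (card_edge eE).
have [L Lm aL] := maximal_block a; have [M Mm bM] := maximal_block b.
have epE : endpoints s e = [set L; M] by rewrite E; exact: endpoints2.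
by rewrite epE cards2 eqSS eqb1 => LM; exists a, b, L, M.
Qed.

(** The maximal member around one extreme separates an external edge; conversely, by [inv_linked],
    no saturated set splits a maximal member. This brings external edges within reach of the
    exchange lemmas. *)
Lemma external_separated e :
  (e \in external I s) = (e \in edges I) && separated (edge_set s) e.
Proof.
apply/idP/andP => [ex|[eE /separatedP[X sX eX]]].
  split; first by move: ex; rewrite inE => /andP[].
  have [a [b [L [M [ab E [Lm Mm] [aL bM] [LM _]]]]]] := external_split ex.
  apply/separatedP; exists L; first exact: inv_saturated.
  rewrite E crosses2 // aL; apply: contra LM => bL; apply/eqP; exact: maximal_eq_mem bL bM.
rewrite inE eE; have [a [b [ab E]]] := edgeP (card_edge eE).
have [L Lm aL] := maximal_block a; have [M Mm bM] := maximal_block b.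
rewrite E (endpoints2 Lm Mm aL bM) cards2 eqSS eqb1.
apply/negP => /eqP LM.
have sub v (N : {set V}) : v \in N -> N \in maximal s -> v \in X -> N \subset X.
  move=> vN Nm vX; apply: (inv_linked J (maximal_family Nm) sX).
  by apply/set0Pn; exists v; rewrite inE vN.
move: eX; rewrite E crosses2 //; case aX: (a \in X) => /= bX.
  by rewrite (subsetP (sub a L aL Lm aX) b) // LM in bX.
by rewrite (subsetP (sub b M bM Mm bX) a) // -LM in aX.
Qed.

(* The maximal sets depend only on the cycle closure of the forest. *)
Lemma maximal_components : maximal s =
  [set L | minset (fun X => (X != set0) && saturated (edge_set s) X) L].
Proof.
apply/setP => L; rewrite [RHS]inE; apply/idP/minsetP => [Lm|].
  split; first by rewrite (inv_neq0 J) ?(inv_saturated J) // maximal_family.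
  move=> X /andP[X0 sX] XL; apply/eqP; rewrite eqEsubset XL.
  apply: (inv_linked J) => //; first exact: maximal_family.
  by rewrite (setIidPr XL).
case=> /andP[/set0Pn[v vL] sL] Lmin; have [M Mm vM] := maximal_block v.
have <- // : M = L; apply: Lmin.
  by rewrite (inv_neq0 J) ?(inv_saturated J) // maximal_family.
apply: (inv_linked J) => //; first exact: maximal_family.
by apply/set0Pn; exists v; rewrite inE vM.
Qed.

End Partition.

Lemma invariant_initial : invariant (initial_state R V).
Proof.
have fam v : [set v] \in family (initial_state R V) by apply: imset_f.
split=> //=.
- exact: sub0set.
- by move=> L /imsetP[v _ ->]; apply/set0Pn; exists v; rewrite inE.
- move=> A B /imsetP[a _ ->] /imsetP[b _ ->]; have [->|ab] := eqVneq a b.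
    by constructor 1.
  by constructor 3; rewrite disjoints1 inE.
- by move=> L _; apply/saturatedP => e; rewrite inE.
- move=> L /imsetP[v _ ->] X _ /set0Pn[w]; rewrite !inE sub1set.
  by case/andP => /eqP ->.
- by move=> L; rewrite inE.
- by move=> L; rewrite ffunE eqxx.
- move=> L _; rewrite /set_load big1 => [|S _]; last by rewrite ffunE.
  rewrite /set_penalty adde_ge0 //; first by apply: sume_ge0 => v _; exact: penalty_ge0.
  by rewrite lee_fin mulr_ge0.
by move=> e eE; rewrite /edge_load big1 ?cost_ge0 // => L _; rewrite ffunE.
Qed.

(** * Growth of the dual vector *)

Lemma dual_grow s S :
  dual (grow I lambda s) S =
  dual s S + (if S \in active s then increment I lambda s else 0).
Proof. by rewrite ffunE; case: ifP; rewrite ?addr0. Qed.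

(** Active sets are maximal, so the only one that can lie inside [L] is [L] itself. *)
Lemma set_load_grow s L : L \in maximal s ->
  set_load (grow I lambda s) L =
  set_load s L + (if L \in active s then increment I lambda s else 0).
Proof.
move=> Lm; rewrite /set_load (eq_bigr _ (fun S _ => dual_grow s S)) big_split /=.
congr (_ + _); rewrite -big_mkcondr /=.
have only S : S \in active s -> S \subset L -> S = L.
  by move/active_maximal/maximalP => [_ h] /h ->; rewrite // maximal_family.
case: ifP => La; [rewrite (big_pred1 L) // | rewrite big_pred0 //] => S /=.
  by apply/andP/eqP => [[SL Sa]|->]; [exact: only | rewrite subxx].
by apply/negP => /andP[SL Sa]; rewrite -(only S) ?Sa in La.
Qed.

Lemma edge_load_grow s e :
  edge_load I (grow I lambda s) e = edge_load I s e +
  increment I lambda s * #|[set L in active s | e \in delta I L]|%:R.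
Proof.
rewrite /edge_load (eq_bigr _ (fun S _ => dual_grow s S)) big_split /=.
congr (_ + _); rewrite -big_mkcondr /= sumr_const mulr_natr; congr (_ *+ _).
by apply: eq_card => L; rewrite [RHS]inE andbC.
Qed.

Lemma Delta1_ge0 s : invariant s -> (0 <= Delta1 I s)%E.
Proof.
move=> J; rewrite /Delta1; case: ifP => // _;
apply: le_bigmin => [|e /andP[eE _]]; first exact: leey.
by rewrite lee_fin divr_ge0 // subr_ge0 (inv_cost J).
Qed.

Lemma Delta2_ge0 s : invariant s -> (0 <= Delta2 I lambda s)%E.
Proof.
move=> J; rewrite /Delta2; case: ifP => // _; apply: le_bigmin => [|L La]; first exact: leey.
by rewrite suber_ge0 // (inv_penalty J) // active_maximal.
Qed.

(** [fine] turns an infinite minimum into 0, and then both bounds are just the non-negativity of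
    [Delta1] and [Delta2]. *)
Lemma increment_le s : invariant s ->
  ((increment I lambda s)%:E <= Delta1 I s)%E /\
  ((increment I lambda s)%:E <= Delta2 I lambda s)%E.
Proof.
move=> J; apply/andP; rewrite -le_min /increment.
have : (0 <= Order.min (Delta1 I s) (Delta2 I lambda s))%E.
  by rewrite le_min Delta1_ge0 ?Delta2_ge0.
by case: (Order.min _ _).
Qed.

Lemma increment_eq0 s : invariant s ->
  tight_external I s != set0 \/ tight_active I lambda s != set0 ->
  increment I lambda s = 0.
Proof.
move=> J tight; rewrite /increment.
have := Delta1_ge0 J; have := Delta2_ge0 J.
case: tight => t0; rewrite /Delta1 /Delta2 t0 => h1 h2.
  by rewrite min_l.
by rewrite min_r.
Qed.

(** This keeps both executions at the same dual vector while tight items remain, so that they can be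
    compared item by item. *)
Lemma grow_id s : invariant s ->
  tight_external I s != set0 \/ tight_active I lambda s != set0 ->
  grow I lambda s = s.
Proof.
move=> J tight; have := increment_eq0 J tight; rewrite /grow => ->.
case: s J tight => F Ls Bs y _ _ /=; congr State.
by apply/ffunP => L; rewrite ffunE addr0 if_same.
Qed.

Lemma invariant_grow s : invariant s -> invariant (grow I lambda s).
Proof.
move=> J; have [inc1 inc2] := increment_le J; case: (J) => *; split=> //.
- move=> L; rewrite dual_grow; case: ifP => [La _|_]; last by rewrite addr0; exact: inv_support.
  exact/maximal_family/active_maximal.
- move=> L Lm; rewrite set_load_grow //; case: ifP => [La|_]; last first.
    by rewrite addr0; exact: (inv_penalty J).
  rewrite addrC EFinD -leeBrDr //; apply: le_trans inc2 _; rewrite /Delta2.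
  case: ifP => _; last exact: bigmin_le_cond.
  by rewrite suber_ge0 // (inv_penalty J).
- move=> e eE; rewrite edge_load_grow.
  set n := #|_|; have [->|n0] := posnP n; first by rewrite mulr0 addr0 (inv_cost J).
  rewrite addrC -lerBrDr -ler_pdivlMr ?ltr0n // -lee_fin; apply: le_trans inc1 _.
  rewrite /Delta1; case: ifP => _.
    by rewrite lee_fin divr_ge0 // subr_ge0 (inv_cost J).
  apply: (@bigmin_le_cond _ _ _ _ e); rewrite eE /=.
  have /card_gt0P[L] := n0; rewrite inE => /andP[La eL].
  by apply/existsP; exists L; rewrite La.
Qed.

(** * Processing a tight item *)

Lemma set_penalty_root L : root I \in L -> set_penalty I lambda L = +oo%E.
Proof.
move=> rL; rewrite /set_penalty (bigD1 (root I)) //= penalty_root.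
have : (0 <= \sum_(v in L | v != root I) penalty I v)%E.
  by apply: sume_ge0 => v _; exact: penalty_ge0.
by case: (\sum_(_ in L | _) _)%E.
Qed.

Lemma set_tight_root s L : set_tight I lambda s L -> root I \notin L.
Proof. by apply: contraL => rL; rewrite /set_tight set_penalty_root. Qed.

Lemma set_penaltyU L M : [disjoint L & M] ->
  set_penalty I lambda (L :|: M) = (set_penalty I lambda L + set_penalty I lambda M)%E.
Proof.
move=> LM; rewrite /set_penalty cardsU disjoint_setI0 // cards0 subn0.
rewrite (eq_bigl [predU L & M]) => [|v]; last by rewrite !inE.
by rewrite bigU // natrD mulrDr EFinD addeACA.
Qed.

Lemma invariant_process_set s L : invariant s -> L \in tight_active I lambda s ->
  invariant (process s (inr L)).
Proof.
move=> J; rewrite inE => /andP[La Lt]; case: (J) => *; split=> //= B.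
rewrite !inE => /predU1P[->|]; last exact: (inv_blocked J).
by split; [exact/maximal_family/active_maximal | exact: set_tight_root Lt].
Qed.

Section ProcessEdge.
Variables (s : state R V) (e L1 L2 : {set V}) (a b : V).
Hypotheses (J : invariant s) (ab : a != b) (eE : e \in edges I)
  (def_e : e = [set a; b]) (L1m : L1 \in maximal s) (L2m : L2 \in maximal s)
  (aL1 : a \in L1) (bL2 : b \in L2) (L12 : L1 != L2)
  (ends : endpoints s e = [set L1; L2]).

Let L1f := maximal_family L1m.
Let L2f := maximal_family L2m.
Let s1 := process s (inl e).

Lemma family_process : family s1 = (L1 :|: L2) |: family s.
Proof. by rewrite /= ends bigcup_setU !big_set1. Qed.

Lemma endpoints_disjoint : [disjoint L1 & L2].
Proof. by rewrite -setI_eq0; apply: contraR L12 => /(maximal_eq J L1m L2m) ->. Qed.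

Lemma sub_or_disjoint A : A \in family s ->
  [\/ A \subset L1, A \subset L2 | [disjoint A & L1 :|: L2]].
Proof.
move=> Af; have [M Mm AM] := maximal_above Af.
have [<-|M1] := eqVneq M L1; first by constructor 1.
have [<-|M2] := eqVneq M L2; first by constructor 2.
constructor 3; apply: disjointWl AM _; rewrite -setI_eq0 setIUr setU_eq0.
apply/andP; split.
  by apply: contraR M1 => /(maximal_eq J Mm L1m) ->.
by apply: contraR M2 => /(maximal_eq J Mm L2m) ->.
Qed.

Lemma maximal_process M : M \in maximal s1 ->
  M = L1 :|: L2 \/ M \in maximal s /\ ~~ crosses e M.
Proof.
case/maximalP; rewrite family_process => Mf Mmax.
have [->|MU] := eqVneq M (L1 :|: L2); [by left | right].
have Mm : M \in maximal s.
  apply/maximalP; split; first by move: Mf; rewrite !inE (negPf MU).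
  by move=> N Nf; apply: Mmax; rewrite inE Nf orbT.
split=> //; apply/negP => eM; have : M \in endpoints s e.
  by rewrite inE Mm /= crosses_meets.
rewrite ends => /set2P ME; case/eqP: MU; rewrite -(Mmax (L1 :|: L2)) ?setU11 //.
by case: ME => ->; rewrite ?subsetUl ?subsetUr.
Qed.

(** Only members of the family carry weight. Each one inside the union lies in [L1] or in [L2], and,
    being non-empty, not in both; the union itself is not yet a member. *)
Lemma set_load_merge : set_load s (L1 :|: L2) = set_load s L1 + set_load s L2.
Proof.
rewrite /set_load !(big_mkcond (fun S => S \subset _)) -big_split /=; apply: eq_bigr => S _.
have [->|/(inv_support J) Sf] := eqVneq (dual s S) 0; first by rewrite !if_same addr0.
have /set0Pn[v vS] := inv_neq0 J Sf.
have notin M : v \notin M -> (S \subset M) = false.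
  by move=> vM; apply/negP => /subsetP/(_ v vS); rewrite (negPf vM).
case: (sub_or_disjoint Sf) => [S1|S2|dS].
- have vL1 := subsetP S1 v vS; rewrite S1 (subset_trans S1) ?subsetUl //.
  by rewrite (notin L2) ?addr0 //; rewrite (disjointFr endpoints_disjoint).
- have vL2 := subsetP S2 v vS; rewrite S2 (subset_trans S2) ?subsetUr //.
  by rewrite (notin L1) ?add0r //; rewrite (disjointFl endpoints_disjoint).
have := disjointFr dS vS; rewrite inE => /negbT; rewrite negb_or => /andP[v1 v2].
by rewrite !notin ?addr0 // inE negb_or v1.
Qed.

Lemma invariant_process_edge : invariant s1.
Proof.
case: (J) => *.
have e_sub : e \subset L1 :|: L2 by rewrite def_e subUset !sub1set !inE aL1 bL2 orbT.
have e_merge : ~~ crosses e (L1 :|: L2).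
  by rewrite /crosses (setIidPl e_sub) (card_edge eE).
split=> //.
- by rewrite subUset sub1set eE (inv_edges J).
- by move=> v; rewrite family_process inE (inv_set1 J) orbT.
- move=> L; rewrite family_process => /setU1P[->|]; last exact: (inv_neq0 J).
  by apply/set0Pn; exists a; rewrite inE aL1.
- have lamU A : A \in family s -> A \subset L1 :|: L2 \/ [disjoint A & L1 :|: L2].
    case/sub_or_disjoint => [A1|A2|]; [left|left|by right].
      exact: subset_trans A1 (subsetUl _ _).
    exact: subset_trans A2 (subsetUr _ _).
  move=> A B; rewrite family_process => /setU1P[->|Af] /setU1P[->|Bf].
  + by constructor 1.
  + by case: (lamU B Bf) => h; [constructor 2|constructor 3; rewrite disjoint_sym].
  + by case: (lamU A Af) => h; [constructor 1|constructor 3].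
  + exact: (inv_laminar J).
- move=> L /maximal_process Lc; rewrite saturatedU1;
  case: Lc => [->|[Lm ->]]; last exact: (inv_saturated J).
  rewrite e_merge; apply/saturatedP => f fF.
  have /saturatedP/(_ f fF) := inv_saturated J L1m.
  have /saturatedP/(_ f fF) := inv_saturated J L2m.
  have [c [d [cd ->]]] := edgeP (inv_card J fF); rewrite !crosses2 // !inE.
  by do 4!case: (_ \in _).
- move=> L Lf X; rewrite saturatedU1 => /andP[eX sX]; move: Lf.
  rewrite family_process => /setU1P[->|Lf]; last exact: (inv_linked J).
  have h1 := inv_linked J L1f sX; have h2 := inv_linked J L2f sX.
  have meet v M : v \in M -> v \in X -> M :&: X != set0.
    by move=> vM vX; apply/set0Pn; exists v; rewrite inE vM.
  (* As [e] does not cross [X], both extremes lie in [X] or neither does; hence a saturated [X] that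
     meets [L1] or [L2] contains both. *)
  have abX : (a \in X) = (b \in X).
    by move: eX; rewrite def_e crosses2 //; do 2!case: (_ \in X).
  have both : a \in X -> L1 :|: L2 \subset X.
    move=> aX; rewrite subUset h1 ?(meet a) //= h2 // (meet b) //.
    by rewrite -abX.
  rewrite setIUl setU_eq0 negb_and => /orP[/h1/subsetP/(_ a aL1)|/h2/subsetP/(_ b bL2)] //.
  by rewrite -abX.
- move=> L /(inv_blocked J)[Lf rL]; split=> //.
  by rewrite family_process inE Lf orbT.
- by move=> L /(inv_support J) Lf; rewrite family_process inE Lf orbT.
- move=> L /maximal_process [->|[Lm _]]; last exact: (inv_penalty J).
  rewrite (set_penaltyU endpoints_disjoint) [set_load _ _]set_load_merge EFinD.
  by rewrite leeD ?(inv_penalty J).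
Qed.

End ProcessEdge.

Lemma invariant_process s x : invariant s -> candidate I lambda s x ->
  invariant (process s x).
Proof.
move=> J; case: x => [e|L] /=; last exact: invariant_process_set.
rewrite inE => /andP[ex _]; have eE : e \in edges I by move: ex; rewrite inE => /andP[].
have [a [b [L [M [ab E [Lm Mm] [aL bM] [LM ends]]]]]] := external_split J ex.
exact: (invariant_process_edge J ab eE E Lm Mm aL bM LM ends).
Qed.

(** * Comparison of two executions *)

Lemma leastP (T : finType) (le : rel T) (A : {set T}) x :
  least le A = Some x -> x \in A /\ {in A, forall z, le x z}.
Proof.
rewrite /least; case: pickP => // y /andP[yA /forallP yle] [<-].
by split=> // z zA; have := yle z; rewrite zA.
Qed.

Lemma default_item_candidate s x :
  default_item I lambda s = Some x -> candidate I lambda s x.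
Proof.
rewrite /default_item; case: ifP => _.
  by case L: (least _ _) => [e|] //= [<-] /=; have [] := leastP L.
by case L: (least _ _) => [e|] //= [<-] /=; have [] := leastP L.
Qed.

Lemma select_candidate tau j s x :
  select I lambda tau j s = Some x -> candidate I lambda s x.
Proof.
rewrite /select; case: (onth tau j) => [y|]; last exact: default_item_candidate.
case: ifP => [cy [<-] //|_]; exact: default_item_candidate.
Qed.

Lemma candidate_tight s x : candidate I lambda s x ->
  tight_external I s != set0 \/ tight_active I lambda s != set0.
Proof. by case: x => [e|L] /= xs; [left|right]; apply/set0Pn; [exists e|exists L]. Qed.

Lemma invariant_growth tau p s : growth I lambda tau p s -> invariant s.
Proof.
elim=> {p s} [|p s x _ J _ sel]; first exact: invariant_initial.
apply: invariant_process (select_candidate sel); exact: invariant_grow.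
Qed.

(* A run of the growth phase past the end of its tie-breaking list. *)
Inductive default_run : state R V -> state R V -> Prop :=
| DefaultStop s : active s = [set setT] -> default_run s s
| DefaultStep s x t : active s != [set setT] ->
    default_item I lambda (grow I lambda s) = Some x ->
    default_run (process (grow I lambda s) x) t -> default_run s t.

Lemma default_run_invariant s t : default_run s t -> invariant s -> invariant t.
Proof.
elim=> {s t} // s x t _ sel _ IH J; apply: IH.
apply: invariant_process (default_item_candidate sel); exact: invariant_grow.
Qed.

Lemma default_run_inv s t : default_run s t ->
  active s = [set setT] /\ t = s \/
  exists x, [/\ active s != [set setT],
    default_item I lambda (grow I lambda s) = Some x &
    default_run (process (grow I lambda s) x) t].
Proof. by case=> [{}s ?|{}s x {}t ? ? ?]; [left | right; exists x]. Qed.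

Lemma in_tight_active s S :
  (S \in tight_active I lambda s) = (S \in active s) && set_tight I lambda s S.
Proof. by rewrite inE. Qed.

Lemma maximal_setT s : invariant s -> setT \in maximal s -> external I s = set0.
Proof.
move=> J Tm; apply/setP => e; rewrite [RHS]inE; apply/negP => ex.
have [a [b [L [M [_ _ [Lm Mm] [aL bM] [/eqP LM _]]]]]] := external_split J ex.
by case: LM; rewrite -(maximal_eq_mem J Tm Lm (in_setT a) aL)
  -(maximal_eq_mem J Tm Mm (in_setT b) bM).
Qed.

Lemma external_not_final s e : invariant s -> e \in external I s ->
  active s != [set setT].
Proof.
move=> J ex; apply/eqP => fin; have Tm : setT \in maximal s.
  by apply: active_maximal; rewrite fin set11.
by move: ex; rewrite (maximal_setT J Tm) inE.
Qed.

Lemma tight_not_final s S : invariant s -> S \in maximal s -> set_tight I lambda s S ->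
  active s != [set setT].
Proof.
move=> J Sm /set_tight_root rS; apply/eqP => fin.
have Tm : setT \in maximal s by apply: active_maximal; rewrite fin set11.
have /set0Pn[v vS] := inv_neq0 J (maximal_family Sm).
by rewrite (maximal_eq_mem J Sm Tm vS (in_setT v)) inE in rS.
Qed.

(* The two states may differ in their forests and in the non-maximal blocked
   sets D, neither of which affects the future of the growth phase. *)
Record agree (D : {set {set V}}) s1 s2 : Prop := Agree {
  agree_sat : saturated (edge_set s1) =1 saturated (edge_set s2);
  agree_dual : dual s1 = dual s2;
  agree_blocked : blocked s1 = D :|: blocked s2;
  agree_D : {in D, forall S, ~~ saturated (edge_set s2) S}
}.

Lemma maximal_sat s1 s2 : invariant s1 -> invariant s2 ->
  saturated (edge_set s1) =1 saturated (edge_set s2) -> maximal s1 = maximal s2.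
Proof.
move=> J1 J2 sat; rewrite !maximal_components //; apply/setP => L; rewrite !inE.
by apply: minset_eq => X; rewrite sat.
Qed.

Lemma separated_sat s1 s2 e :
  saturated (edge_set s1) =1 saturated (edge_set s2) ->
  separated (edge_set s1) e = separated (edge_set s2) e.
Proof. by move=> sat; apply: eq_existsb => X; rewrite sat. Qed.

Lemma tight_external_eq s1 s2 : maximal s1 = maximal s2 -> dual s1 = dual s2 ->
  tight_external I s1 = tight_external I s2.
Proof.
by move=> em ed; apply/setP => e; rewrite !inE /endpoints /edge_tight /edge_load em ed.
Qed.

Lemma tight_active_eq s1 s2 : active s1 = active s2 -> dual s1 = dual s2 ->
  tight_active I lambda s1 = tight_active I lambda s2.
Proof.
by move=> ea ed; rewrite /tight_active ea /set_tight /set_load ed.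
Qed.

(** A set of [D] is not saturated, hence not maximal, so blocking it leaves the active sets
    unchanged. *)
Lemma agree_active D s1 s2 : invariant s1 -> invariant s2 -> agree D s1 s2 ->
  active s1 = active s2.
Proof.
move=> J1 J2 [sat _ eb nD]; rewrite /active (maximal_sat J1 J2 sat) eb.
apply/setP => L; rewrite !inE; case LD: (L \in D) => //=.
apply/esym/negP => /andP[_ Lm]; have := nD L LD.
by rewrite (inv_saturated J2) // inE.
Qed.

Lemma agree_grow D s1 s2 : invariant s1 -> invariant s2 -> agree D s1 s2 ->
  agree D (grow I lambda s1) (grow I lambda s2).
Proof.
move=> J1 J2 A; have ea := agree_active J1 J2 A; case: (A) => sat ed eb nD.
have em := maximal_sat J1 J2 sat.
split=> //; apply/ffunP => L; rewrite !dual_grow ea ed; congr (_ + _).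
suff -> : increment I lambda s1 = increment I lambda s2 by [].
rewrite /increment /Delta1 /Delta2 (tight_external_eq em ed) (tight_active_eq ea ed).
by rewrite ea /edge_load /set_load ed.
Qed.

Lemma agree_default_item D s1 s2 : invariant s1 -> invariant s2 -> agree D s1 s2 ->
  default_item I lambda s1 = default_item I lambda s2.
Proof.
move=> J1 J2 A; have ea := agree_active J1 J2 A; case: (A) => sat ed _ _.
by rewrite /default_item (tight_external_eq (maximal_sat J1 J2 sat) ed) (tight_active_eq ea ed).
Qed.

Lemma agree_process D s1 s2 x : agree D s1 s2 -> agree D (process s1 x) (process s2 x).
Proof.
case: x => [e|L] [sat ed eb nD]; split=> //=.
- by move=> X; rewrite !saturatedU1 sat.
- by move=> S SD; rewrite saturatedU1 negb_and nD ?orbT.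
- by rewrite eb setUCA.
Qed.

(** Both runs process the same items, and [C] collects the edges among them. Such an edge was
    external when added, and a newly blocked set was maximal when blocked; as forests only grow,
    both facts pull back to [s2]. They later show that the disputed item is missing from the run of
    [s2]. *)
Lemma agree_run D s1 s2 t1 t2 : default_run s2 t2 -> default_run s1 t1 ->
  invariant s1 -> invariant s2 -> agree D s1 s2 ->
  dual t1 = dual t2 /\ blocked t1 = D :|: blocked t2 /\
  {in blocked t2, forall S, S \in blocked s2 \/ saturated (edge_set s2) S} /\
  exists C : {set {set V}},
    [/\ edge_set t1 = C :|: edge_set s1, edge_set t2 = C :|: edge_set s2 &
        {in C, forall e, separated (edge_set s2) e}].
Proof.
move=> run2; elim: run2 s1 => {s2 t2} [s2 fin2|s2 x t2 nfin2 def2 _ IH] s1 run1 J1 J2 A.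
  have fin1 := agree_active J1 J2 A; rewrite fin2 in fin1.
  case/default_run_inv: run1 => [[_ ->]|[y [/eqP//]]].
  case: A => _ ed eb _; do 2!split=> //; split; first by left.
  by exists set0; split=> [||e]; rewrite ?set0U ?inE.
have nfin1 := agree_active J1 J2 A; rewrite -nfin1 in nfin2.
case/default_run_inv: run1 => [[fin1]|[y [_ def1 run1]]]; first by rewrite fin1 eqxx in nfin2.
have J1g := invariant_grow J1; have J2g := invariant_grow J2.
have Ag := agree_grow J1 J2 A.
have xy : x = y by apply: Some_inj; rewrite -def1 -def2 (agree_default_item J1g J2g Ag).
have cx := default_item_candidate def2; have cy := default_item_candidate def1.
subst y.
have [] := IH _ run1 (invariant_process J1g cy) (invariant_process J2g cx) (agree_process x Ag).
move=> -> [-> [new [C [C1 C2 sC]]]]; do 2!split=> //; split=> [S /new|].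
  case: x {def1 def2 run1 IH C1 C2 sC new} cx cy => [e|L] /= cx cy.
    by case; [left | rewrite saturatedU1 => /andP[_]; right].
  rewrite !inE => -[/predU1P[->|]|]; [right|by left|by right].
  by apply: (inv_saturated J2g); apply: active_maximal; move: cx; rewrite inE => /andP[].
case: x {def1 def2 run1 IH new} C1 C2 sC cx cy => [e|L] /= C1 C2 sC cx cy; last by exists C.
exists (e |: C); rewrite C1 C2 !(setUCA C) !setUA; split=> // f /setU1P[->|/sC].
  by move: cx; rewrite inE (external_separated J2g) => /andP[/andP[]].
exact: separatedU1.
Qed.

(** * Runs that differ by one item processed early *)

Lemma default_item_edge s x : tight_external I s != set0 ->
  default_item I lambda s = Some x -> exists f, [/\ x = inl f,
    f \in tight_external I s & {in tight_external I s, forall g, edge_le I f g}].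
Proof.
rewrite /default_item => ->; case L: (least _ _) => [f|] //= [<-].
by exists f; have [] := leastP L.
Qed.

Lemma default_item_set s x : tight_external I s = set0 ->
  default_item I lambda s = Some x -> exists S, [/\ x = inr S,
    S \in tight_active I lambda s &
    {in tight_active I lambda s, forall S', set_le I S S'}].
Proof.
rewrite /default_item => ->; rewrite eqxx /=; case L: (least _ _) => [f|] //= [<-].
by exists f; have [] := leastP L.
Qed.

Lemma tight_externalP s e : invariant s -> reflect
  [/\ e \in edges I, separated (edge_set s) e & edge_tight I s e]
  (e \in tight_external I s).
Proof.
move=> J; rewrite inE external_separated //.
by apply: (iffP andP) => [[/andP[]]|[-> -> ->]].
Qed.

(** Induction along the run from [s2], whose next item is its first tight edge [f]. Either [f] is
    still external in the presence of [e] and both runs take it, or [f] is spanned once [e] is added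
    and the runs agree from then on. *)
Lemma edge_run e s1 s2 t1 t2 : default_run s2 t2 -> default_run s1 t1 ->
  invariant s1 -> invariant s2 ->
  edge_set s1 = e |: edge_set s2 -> blocked s1 = blocked s2 -> dual s1 = dual s2 ->
  e \in tight_external I s2 ->
  [/\ dual t1 = dual t2, blocked t1 = blocked t2 &
      edge_set t1 = edge_set t2 \/
      e \notin edge_set t2 /\ edge_set t1 \subset e |: edge_set t2].
Proof.
move=> run2; elim: run2 s1 => {s2 t2} [s2 fin2|s2 x t2 nfin2 def2 run2 IH] s1 run1
  J1 J2 eF eb ed eY.
  by move: eY; rewrite inE => /andP[/(external_not_final J2)]; rewrite fin2 eqxx.
have Y2 : tight_external I s2 != set0 by apply/set0Pn; exists e.
have [eE e_sep e_tight] := tight_externalP _ J2 eY.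
rewrite grow_id // in def2 run2 IH; last by left.
have [f [xf fY fmin]] := default_item_edge Y2 def2; subst x.
have [fE f_sep f_tight] := tight_externalP _ J2 fY.
have D2 := inv_card J2; have e2 := card_edge eE; have f2 := card_edge fE.
have J2' : invariant (process s2 (inl f)) by apply: invariant_process.
have [f_sep1|f_span] := boolP (separated (edge_set s1) f).
  have fY1 : f \in tight_external I s1.
    by apply/(tight_externalP _ J1); split=> //; rewrite /edge_tight /edge_load ed.
  have Y1 : tight_external I s1 != set0 by apply/set0Pn; exists f.
  have nfin1 : active s1 != [set setT].
    by move: fY1; rewrite inE => /andP[/(external_not_final J1)].
  case/default_run_inv: run1 => [[fin1]|[y [_ def1 run1]]]; first by rewrite fin1 eqxx in nfin1.
  rewrite grow_id // in def1 run1; last by left.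
  have [g [yg gY gmin]] := default_item_edge Y1 def1; subst y.
  have [gE g_sep g_tight] := tight_externalP _ J1 gY.
  (* Since [s1] only has more forest edges, [g] is tight and external for [s2] as well; minimality
     on both sides and antisymmetry force equality. *)
  have gf : g = f.
    apply: (edge_le_anti gE fE); rewrite gmin // fmin //.
    apply/(tight_externalP _ J2); split=> //; last first.
      by move: g_tight; rewrite /edge_tight /edge_load ed.
    by move: g_sep; rewrite eF; exact: separatedU1.
  subst g.
  have J1' : invariant (process s1 (inl f)) by apply: invariant_process.
  apply: (IH _ run1 J1' J2') => //=; first by rewrite eF setUCA.
  (* The exchange property keeps [e] external on the side that has not processed it. *)
  apply/(tight_externalP _ J2'); split=> //=.
  by apply: separated_exchange => //; rewrite -eF.
have A : agree set0 s1 (process s2 (inl f)).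
  split=> //=; last 1 first.
  - by move=> S; rewrite inE.
  - by rewrite eF; apply: saturated_exchange => //; rewrite -eF.
  - by rewrite set0U.
have [-> [-> [_ [C [-> -> sC]]]]] := agree_run run2 run1 J1 J2' A.
rewrite set0U eF /=; split=> //; have [->|ef] := eqVneq e f; [by left|right].
split; last by rewrite setUCA setUS // setUS // subsetUr.
(* [e] is not in the forest of [s2], which separates it, nor in [C], since the forest of [s2] with
   [f] added already spans [e]. *)
rewrite !inE !negb_or ef; apply/andP; split; last by apply: contraL e_sep; exact: separated_mem.
apply/negP => /sC; rewrite -(separated_sat _ (agree_sat A)).
by apply/negP; apply: separated_mem; rewrite eF setU11.
Qed.

(** Along the run from [s2], [S] stays tight and active until it is blocked, when the difference
    disappears, or until a processed edge crosses it, when the difference stops mattering. *)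
Lemma set_run S s1 s2 t1 t2 : default_run s2 t2 -> default_run s1 t1 ->
  invariant s1 -> invariant s2 ->
  edge_set s1 = edge_set s2 -> blocked s1 = S |: blocked s2 -> dual s1 = dual s2 ->
  S \in tight_active I lambda s2 ->
  [/\ dual t1 = dual t2, edge_set t1 = edge_set t2 &
      blocked t1 = blocked t2 \/
      S \notin blocked t2 /\ blocked t1 = S |: blocked t2].
Proof.
move=> run2; elim: run2 s1 => {s2 t2} [s2 fin2|s2 x t2 nfin2 def2 run2 IH] s1 run1
  J1 J2 eF eb ed SZ.
  move: SZ; rewrite inE => /andP[/active_maximal Sm St].
  by have := tight_not_final J2 Sm St; rewrite fin2 eqxx.
have Z2 : tight_active I lambda s2 != set0 by apply/set0Pn; exists S.
have [Sa St] : S \in active s2 /\ set_tight I lambda s2 S by apply/andP; rewrite -in_tight_active.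
have Sm := active_maximal Sa; have Sb : S \notin blocked s2 by move: Sa; rewrite inE => /andP[].
rewrite grow_id // in def2 run2 IH; last by right.
have sat : saturated (edge_set s1) =1 saturated (edge_set s2) by move=> X; rewrite eF.
have em := maximal_sat J1 J2 sat; have eY := tight_external_eq em ed.
have nfin1 : active s1 != [set setT].
  by apply: (tight_not_final (S := S)) => //; rewrite ?em // /set_tight /set_load ed.
have J2' := invariant_process J2 (default_item_candidate def2).
have [Y0|Y2] := eqVneq (tight_external I s2) set0.
  have [L [xL LZ Lmin]] := default_item_set Y0 def2; subst x.
  have [LS|LS] := eqVneq L S.
    have A : agree set0 s1 (process s2 (inr L)).
      by split=> //= [|X]; rewrite ?set0U ?inE // LS.
    have [-> [-> [_ [C [-> -> _]]]]] := agree_run run2 run1 J1 J2' A.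
    by rewrite eF set0U; split=> //; left.
  (* Blocking [S] early only removes it from the tight active sets, so a first one other than [S] is
     first for both runs. *)
  have eZ : tight_active I lambda s1 = tight_active I lambda s2 :\ S.
    have ea : active s1 = active s2 :\ S.
      by apply/setP => X; rewrite /active em eb in_setD1 !in_setD in_setU1 negb_or andbA.
    apply/setP => X; rewrite in_setD1 !in_tight_active ea in_setD1 andbA.
    by rewrite /set_tight /set_load ed.
  have LZ1 : L \in tight_active I lambda s1 by rewrite eZ in_setD1 LS.
  have Z1 : tight_active I lambda s1 != set0 by apply/set0Pn; exists L.
  case/default_run_inv: run1 => [[fin1]|[y [_ def1 run1]]]; first by rewrite fin1 eqxx in nfin1.
  rewrite grow_id // in def1 run1; last by right.
  have [M [yM MZ Mmin]] := default_item_set (etrans eY Y0) def1; subst y.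
  have ML : M = L.
    apply: (@set_le_anti _ _ I); rewrite Mmin // Lmin //.
    by move: MZ; rewrite eZ => /setD1P[].
  subst M.
  have J1' := invariant_process_set J1 LZ1.
  apply: (IH _ run1 J1' J2') => //=.
  - by rewrite eb setUCA.
  - rewrite in_tight_active; apply/andP; split=> //.
    by rewrite in_setD in_setU1 negb_or eq_sym LS Sb.
have [f [xf fY fmin]] := default_item_edge Y2 def2; subst x.
have Y1 : tight_external I s1 != set0 by rewrite eY.
case/default_run_inv: run1 => [[fin1]|[y [_ def1 run1]]]; first by rewrite fin1 eqxx in nfin1.
rewrite grow_id // in def1 run1; last by left.
have yf : y = inl f.
  by apply: Some_inj; rewrite -def1 -def2 /default_item eY Y2.
subst y.
have J1' : invariant (process s1 (inl f)) by apply: invariant_process; rewrite //= eY.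
have [fS|fS] := boolP (crosses f S).
  (* Once [f] crosses [S], [S] is no longer saturated: the runs may differ by blocking it, and the
     run from [s2] can no longer block it. *)
  have A : agree [set S] (process s1 (inl f)) (process s2 (inl f)).
    split=> //=; first by rewrite eF.
    by move=> X /set1P ->; rewrite saturatedU1 fS.
  have [-> [-> [new [C [-> -> _]]]]] := agree_run run2 run1 J1' J2' A.
  rewrite /= eF; split=> //; right; split=> //; apply/negP => /new /=.
  by rewrite (negPf Sb) saturatedU1 fS; case.
apply: (IH _ run1 J1' J2') => //=; first by rewrite eF.
rewrite inE; apply/andP; split=> //; rewrite inE Sb /=.
(* An uncrossed [S] is still a minimal non-empty saturated set, hence still maximal in the
   family. *)
move: Sm; rewrite (maximal_components J2') (maximal_components J2) !inE /=.
case/minsetP => /andP[S0 sS] Smin; apply/minsetP; split.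
  by rewrite S0 saturatedU1 fS.
by move=> X /andP[X0]; rewrite saturatedU1 => /andP[_ sX]; apply: Smin; rewrite X0.
Qed.

Lemma diverging_runs s x t t' : invariant s -> active s != [set setT] ->
  candidate I lambda (grow I lambda s) x ->
  default_run (process (grow I lambda s) x) t -> default_run s t' ->
  dual t = dual t' /\
  (forest t = forest t' /\ blocked t = blocked t' \/
   match x with
   | inl e => [/\ blocked t = blocked t', e \notin edge_set t'
                & subgraph (forest t) (add_edge (forest t') e)]
   | inr B => [/\ forest t = forest t', B \notin blocked t'
                & blocked t = B |: blocked t']
   end).
Proof.
move=> Js nfin cx run run'; set g := grow I lambda s in cx run.
have Jg : invariant g := invariant_grow Js.
have g_id : grow I lambda g = g := grow_id Jg (candidate_tight cx).
(* As [x] is tight in [g], growing again changes nothing, so the run from [s] can be restarted at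
   [g], where the two executions part. *)
have run_g : default_run g t'.
  case/default_run_inv: run' => [[fin]|[y [_ def run']]]; first by rewrite fin eqxx in nfin.
  by apply: (DefaultStep (x := y)); rewrite // ?g_id.
have Jx : invariant (process g x) := invariant_process Jg cx.
have vt := inv_vset (default_run_invariant run Jx).
have vt' := inv_vset (default_run_invariant run_g Jg).
have forest_eq : edge_set t = edge_set t' -> forest t = forest t'.
  by case: (forest t) (forest t') vt vt' => [? ?] [? ?] /= -> -> ->.
case: x cx run Jx => [e|S] cx run Jx.
  have [|||-> eb [eF|[e_notin sub]]] := edge_run run_g run Jx Jg _ _ _ cx => //.
    by split=> //; left; rewrite forest_eq.
  by split=> //; right; split=> //; split; rewrite //= vt vt'.
have [|||-> eF [eb|[S_notin eb]]] := set_run run_g run Jx Jg _ _ _ cx => //.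
  by split=> //; left; rewrite forest_eq.
by split=> //; right; rewrite forest_eq.
Qed.

Lemma rooted_final s : invariant s -> active s = [set setT] ->
  rooted_graph (root I) (forest s).
Proof.
move=> J fin; split=> [||X rX X0]; first exact: inv_card.
  by move=> e _; rewrite (inv_vset J) subsetT.
have Tm : setT \in maximal s by apply: active_maximal; rewrite fin set11.
apply: contra rX => sX; apply: (subsetP (inv_linked J (maximal_family Tm) sX _)).
  by rewrite setIC -(inv_vset J).
by rewrite inE.
Qed.

Lemma pruning_final_unique s H H' : invariant s -> active s = [set setT] ->
  pruning (blocked s) (forest s) H -> pruning (blocked s) (forest s) H' -> H = H'.
Proof.
move=> J fin; apply: (pruning_unique (r := root I)); last exact: rooted_final.
  by move=> A B /(inv_blocked J)[Af _] /(inv_blocked J)[Bf _]; apply: (inv_laminar J).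
by move=> B /(inv_blocked J)[].
Qed.

End GrowthInvariant.

(** * Determinism, prefixes and default suffixes of executions *)

Section Executions.
Variables (R : realFieldType) (V : finType) (I : instance R V) (lambda : R).
Implicit Types (s t u : state R V) (tau p q : seq (item V)).

Lemma growth_inv tau q t : growth I lambda tau q t ->
  q = [::] /\ t = initial_state R V \/
  exists p x s, [/\ q = rcons p x, growth I lambda tau p s, active s != [set setT],
    select I lambda tau (size p) (grow I lambda s) = Some x &
    t = process (grow I lambda s) x].
Proof. by case=> [|p s x *]; [left | right; exists p, x, s]. Qed.

Lemma growth_rcons tau p x t : growth I lambda tau (rcons p x) t ->
  exists s, [/\ growth I lambda tau p s, active s != [set setT],
    select I lambda tau (size p) (grow I lambda s) = Some x &
    t = process (grow I lambda s) x].
Proof.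
case/growth_inv => [[/(congr1 size)]|[q [y [s [/rcons_inj[-> ->] ? ? ? ?]]]]].
  by rewrite size_rcons.
by exists s.
Qed.

Lemma growth_det tau p q s t : growth I lambda tau p s -> growth I lambda tau q t ->
  size p = size q -> p = q /\ s = t.
Proof.
move=> gp; elim: gp q t => {p s} [|p s x _ IH _ sel] q t.
  by case/growth_inv => [[-> ->] //|[q1 [y [u [-> _ _ _ _]]]]]; rewrite size_rcons.
case/growth_inv => [[-> _]|[q' [y [u [-> gq _ selu ->]]]]]; first by rewrite size_rcons.
rewrite !size_rcons => -[pq]; have [pE sE] := IH _ _ gq pq.
by subst q' u; move: selu; rewrite sel => -[->].
Qed.

Lemma growth_take tau p s n : growth I lambda tau p s -> (n < size p)%N ->
  exists2 t, growth I lambda tau (take n p) t & active t != [set setT].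
Proof.
move=> gp; elim: gp n => {p s} [|p s x gp IH nfin sel] n //.
rewrite size_rcons ltnS leq_eqVlt => /predU1P[->|np].
  by exists s; rewrite // -cats1 take_size_cat.
by rewrite -cats1 take_cat np; exact: IH.
Qed.

Lemma growth_size_le tau p q s t : growth I lambda tau p s -> active s = [set setT] ->
  growth I lambda tau q t -> (size q <= size p)%N.
Proof.
move=> gp fin gq; rewrite leqNgt; apply/negP => pq.
have [u gu] := growth_take gq pq.
have [_ <-] := growth_det gp gu (esym (size_takel (ltnW pq))).
by rewrite fin eqxx.
Qed.

(** Iterations are peeled off the end of [p]: positions count from 0, so from position [size tau] on
    the list offers nothing and the default item is selected. *)
Lemma default_run_suffix tau p t u n : growth I lambda tau p t ->
  default_run I lambda t u -> (size tau <= n <= size p)%N ->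
  exists2 s, growth I lambda tau (take n p) s & default_run I lambda s u.
Proof.
move=> gp; elim: gp n => {p t} [|p s x gp IH nfin sel] n run /andP[tau_n].
  by rewrite leqn0 => /eqP ->; exists (initial_state R V) => //; exact: GrowthInit.
rewrite size_rcons leq_eqVlt => /predU1P[->|].
  exists (process (grow I lambda s) x) => //.
  by rewrite take_oversize ?size_rcons //; exact: GrowthStep.
rewrite ltnS => np; rewrite -cats1 takel_cat //; apply: IH; rewrite ?tau_n //.
apply: DefaultStep nfin _ run; move: sel; rewrite /select.
by rewrite onth_default // (leq_trans tau_n).
Qed.

Lemma growth_list_prefix tau p s : growth I lambda tau p s ->
  (size p <= (size tau).-1)%N -> growth I lambda (list_prefix tau) p s.
Proof.
elim=> {p s} [|p s x gp IH nfin sel]; first by move=> _; exact: GrowthInit.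
rewrite size_rcons => lt; apply: GrowthStep (IH (ltnW lt)) nfin _; rewrite -sel.
suff tauE : onth (list_prefix tau) (size p) = onth tau (size p) by rewrite /select tauE.
by rewrite !onthE /list_prefix map_take nth_take.
Qed.

End Executions.

Unset Implicit Arguments.

Theorem lemma16 (R : realFieldType) (V : finType) (I : instance R V)
    (lambda : R) (tau : seq (item V)) (sigma : item V)
    (p p' : seq (item V)) (s s' : state R V)
    (hlambda : 0 <= lambda)
    (htau : tie_breaking_list I tau)
    (hthreshold : threshold_tuple I lambda tau)
    (hsigma : onth tau (size tau).-1 = Some sigma)
    (hGP : GP I lambda tau p s)
    (hGP' : GP I lambda (list_prefix tau) p' s') :
  dual s = dual s' /\
  match sigma with
  | inl e => [/\ blocked s = blocked s', e \notin eset (forest s')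
               & subgraph (forest s) (add_edge (forest s') e)]
  | inr B => [/\ forest s = forest s', B \notin blocked s'
               & blocked s = B |: blocked s']
  end.
Proof.
case: hthreshold => tau0 [p0 [s0 [[g0 fin0] pre0]]] [H [H' [GWH GWH' sizes]]].
case: hGP hGP' => g fin [g' fin'].
have GP_det tau1 q1 q2 t1 t2 : GP I lambda tau1 q1 t1 -> GP I lambda tau1 q2 t2 ->
    q1 = q2 /\ t1 = t2.
  move=> [h1 f1] [h2 f2]; apply: (growth_det h1 h2); apply/eqP.
  by rewrite eqn_leq (growth_size_le h1 f1 h2) (growth_size_le h2 f2 h1).
(* Being respected only yields some execution; determinism identifies it with the given one, so [p]
   begins with [tau]. *)
have [p0p _] := GP_det _ _ _ _ _ (conj g0 fin0) (conj g fin); subst p0.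
have tau_p : (size tau <= size p)%N by rewrite -pre0 size_take_min geq_minr.
have [s1 g1 run] : exists2 s1, growth I lambda tau tau s1 & default_run I lambda s1 s.
  rewrite -{2}pre0; apply: default_run_suffix g _ _; last by rewrite leqnn.
  exact: DefaultStop.
have tauE : tau = rcons (list_prefix tau) sigma.
  case/lastP: tau tau0 hsigma {htau g0 pre0 GWH GWH' g g' tau_p g1} => // q x _.
  rewrite /list_prefix size_rcons /= -(cats1 q x) onth_cat ltnn subnn take_size_cat // => -[->].
  by rewrite cats1.
have [u [gu nfin sel s1E]] : exists u, [/\ growth I lambda tau (list_prefix tau) u,
    active u != [set setT],
    select I lambda tau (size (list_prefix tau)) (grow I lambda u) = Some sigma &
    s1 = process (grow I lambda u) sigma].
  by apply: growth_rcons; rewrite -tauE.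
have szq : size (list_prefix tau) = (size tau).-1 by rewrite {2}tauE size_rcons.
(* Both lists have the same entries in the first [(size tau).-1] positions, so both executions pass
   through [u]. *)
have gu' : growth I lambda (list_prefix tau) (list_prefix tau) u.
  by apply: growth_list_prefix; rewrite ?szq.
have le_p' := growth_size_le g' fin' gu'.
have [u' gt' run'] := default_run_suffix g' (DefaultStop I lambda fin')
  (introT andP (conj (leqnn _) le_p')).
have [_ uu'] := growth_det gu' gt' (esym (size_takel le_p')); subst u'.
have Ju := invariant_growth hlambda gu.
rewrite s1E in run.
have [-> [[eF eb]|//]] := diverging_runs Ju nfin (select_candidate sel) run run'.
(* In the remaining case both executions return the same pair, so the pruned trees coincide and
   their sizes cannot lie on opposite sides of the quota. *)
have Js' := default_run_invariant run' Ju.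
case: GWH GWH' => [q1 [t1 [GP1 prun]]] [q2 [t2 [GP2 prun']]].
have [_ t1s] := GP_det _ _ _ _ _ GP1 (conj g fin).
have [_ t2s] := GP_det _ _ _ _ _ GP2 (conj g' fin').
rewrite t1s eF eb in prun; rewrite t2s in prun'.
rewrite (pruning_final_unique Js' fin' prun prun') in sizes.
by case: sizes => /andP[lt le]; move: (leq_trans lt le); rewrite ltnn.
Qed.
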